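(* Let $T>0$. If $0<\sigma<1$, $1<p,q<\infty$, $\frac{1}{2}\big(1+\frac{1}{p}\big)<\alpha<1$, $\omega\in A^+_{(p,q)}$, $0\leq\beta,\mu<1$, $1/p-1/q=\sigma$ and $q+\mu\leq2$, then the operator $$u\longmapsto \frac{\chi_{(0,T)}(t)}{\Gamma(\alpha)}\int_{0}^{t}\frac{u(\tau)}{(t-\tau)^{1-\alpha}}\,d\tau$$ is a compact operator from $L^{p,\beta}_+((0,T),\omega^p)$ to $L^{q,\mu}_+((0,T),\omega^q)$.
   Context: A weight $\omega$ is a positive function on $\mathbb{R}$; $p'$ is the conjugate exponent of $p$; $\chi_E$ is the characteristic function of $E$. Weight class: for $1<p<q$ and $1/p-1/q=\sigma\in(0,1)$, $\omega\in A^+_{(p,q)}$ means that there is a constant $C$ with $$\frac{1}{(c-a)^{1-\sigma}}\Big(\int_a^b\omega^q\Big)^{1/q}\Big(\int_b^c\omega^{-p'}\Big)^{1/p'}<C\quad\text{for all } a<b<c\text{ in }\mathbb{R}.$$ Local one-sided weighted Morrey space: for $1\le p<\infty$, $0\le\lambda<1$, $1\le\theta<\infty$, put $\Phi_{\omega,\lambda,\theta}^{+}(x_0,h)=h^{\lambda-1}\int_{x_0-h}^{x_0}\omega(x)^\theta\,dx$. Then $L^{p,\lambda}_+((0,T),\omega^\theta)$ consists of the functions $f$ on $(0,T)$ with $$\|f\|_{L^{p,\lambda}_{+}((0,T),\omega^\theta)}=\sup_{0\leq x_0\leq T,\ 0<h\leq T}\Big(\frac{1}{\Phi_{\omega,\lambda,\theta}^{+}(x_0,h)}\int_{(x_0,x_0+h)\cap(0,T)}|f(y)|^p\,dy\Big)^{1/p}<\infty.$$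 Thus $L^{p,\beta}_+((0,T),\omega^p)$ uses $\Phi^+_{\omega,\beta,p}$, and $L^{q,\mu}_+((0,T),\omega^q)$ uses $\Phi^+_{\omega,\mu,q}$ with integrability exponent $q$. *)

(* Defs.v *)
From mathcomp Require Import all_boot all_order all_algebra.
From mathcomp Require Import all_classical all_reals all_analysis.

Set Implicit Arguments.
Unset Strict Implicit.
Unset Printing Implicit Defensive.

Import Order.TTheory GRing.Theory Num.Theory.
Import numFieldNormedType.Exports.

Local Open Scope classical_set_scope.
Local Open Scope ring_scope.

Definition conj_exp (R : realType) (p : R) : R := p / (p - 1).

Definition weight (R : realType) (w : R -> R) : Prop :=
  measurable_fun setT w /\ forall x, 0 < w x.

(* Stated for integrals in \bar R: since w > 0, both are nonzero, so the bound
   forces both to be finite. *)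
Definition A_plus (R : realType) (p q : R) (w : R -> R) : Prop :=
  let sigma := p^-1 - q^-1 in
  let p' := conj_exp p in
  exists C : R, forall a b c : R, a < b -> b < c ->
    ((((c - a) `^ (1 - sigma))^-1)%:E
     * poweR (\int[lebesgue_measure]_(x in `]a, b[) (w x `^ q)%:E) q^-1
     * poweR (\int[lebesgue_measure]_(x in `]b, c[) (w x `^ (- p'))%:E) p'^-1
     < C%:E)%E.

Definition Phi_plus (R : realType) (w : R -> R) (lambda theta x0 h : R)
    : \bar R :=
  ((h `^ (lambda - 1))%:E
   * \int[lebesgue_measure]_(x in `](x0 - h)%R, x0[) (w x `^ theta)%:E)%E.

(* A function on (0,T) is represented by a total function on R whose values
   outside ]0,T[ are irrelevant. *)
Definition morrey_norm (R : realType) (T p lambda theta : R) (w f : R -> R)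
    : \bar R :=
  ereal_sup [set N : \bar R | exists x0 h : R,
    [/\ 0 <= x0 <= T, 0 < h <= T
      & N = poweR ((Phi_plus w lambda theta x0 h)^-1
                   * \int[lebesgue_measure]_(y in
                        `]x0, (x0 + h)%R[ `&` `]0%R, T[) (`|f y| `^ p)%:E)%E
                  p^-1]].

Definition morrey_space (R : realType) (T p lambda theta : R) (w : R -> R)
    : set (R -> R) :=
  [set f | measurable_fun `]0, T[ f
           /\ (morrey_norm T p lambda theta w f < +oo)%E].

Definition Gamma (R : realType) (a : R) : R :=
  \int[lebesgue_measure]_(x in `]0, +oo[) (x `^ (a - 1) * expR (- x)).

Definition frac_kernel (R : realType) (alpha : R) (u : R -> R) (t tau : R) : R :=
  u tau / (t - tau) `^ (1 - alpha).

Definition frac_int (R : realType) (T alpha : R) (u : R -> R) : R -> R :=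
  fun t => \1_(`]0, T[) t / Gamma alpha
           * \int[lebesgue_measure]_(tau in `]0, t[) frac_kernel alpha u t tau.

(* Sequential form: Y is a space of functions with norm nY, functions at
   distance zero being identified. *)
Definition relatively_compact (R : realType)
    (Y : set (R -> R)) (nY : (R -> R) -> \bar R) (S : set (R -> R)) : Prop :=
  forall v_ : nat -> R -> R, (forall n, S (v_ n)) ->
    exists (phi : nat -> nat) (g : R -> R),
      [/\ forall m n, (m < n)%N -> (phi m < phi n)%N,
          Y g
        & nY (v_ (phi n) \- g) @[n --> \oo] --> 0%E].

(* As elements of the spaces are classes of functions, linearity is an equality
   up to norm zero. *)
Definition compact_operator (R : realType)
    (X : set (R -> R)) (nX : (R -> R) -> \bar R)
    (Y : set (R -> R)) (nY : (R -> R) -> \bar R)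
    (K : (R -> R) -> (R -> R)) : Prop :=
  [/\ forall u, X u -> Y (K u),
      forall (a : R) u v, X u -> X v ->
        nY (K (fun x => a * u x + v x) \- (fun x => a * K u x + K v x)) = 0%E
    & forall B : set (R -> R), B `<=` X ->
        (exists M : R, forall u, B u -> (nX u <= M%:E)%E) ->
        relatively_compact Y nY (K @` B)].

(* Main.v *)
Require Import Defs.
From mathcomp Require Import all_boot all_order all_algebra.
From mathcomp Require Import all_classical all_reals all_analysis.
From mathcomp Require Import measurable_realfun ring lra.

(** The Morrey spaces only enter through two comparisons with unweighted
    spaces, and between these the classical compactness of the fractional
    integral from [L^p(0,T)] to the continuous functions does the work.

    On the source side, the pair [x0 = 0], [h = T] in the supremum bounds
    [\int_0^T |u|^p] by the norm of [u], because [\int_{-T}^0 w^p] is finite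
    ([morrey_norm_Lp]): the condition [A_plus] makes [w^q] locally integrable,
    and [p < q].  So a bounded set of the source lies in a ball of [L^p(0,T)].

    The hypothesis on [alpha] gives [alpha > 1/p].  Hence the kernel
    [(t - x)^(alpha - 1)] lies in [L^p'] with [p'] conjugate to [p], and it
    moves continuously there: the [p']-th power of the distance between the
    kernels at [s] and [t] is at most a constant times [|t - s|^e], where
    [e = (alpha - 1) p' + 1 > 0] ([integral_rl_kernel_diff]).  Pairing with [u]
    shows that the fractional integrals of a ball of [L^p(0,T)] are uniformly
    bounded and equicontinuous on [(0,T)] ([frac_int_bounded],
    [frac_int_equicontinuous]), so every sequence of them has a uniformly
    convergent subsequence ([ascoli_sequence]).

    On the target side, uniform convergence implies convergence in the Morrey
    norm ([morrey_norm_le_sup]).  This needs [h^(2 - mu)] to be at most a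
    constant times [\int_{x0-h}^{x0} w^q].  Local integrability of [w^(-p')]
    forces [\int_{x0-h}^{x0} w^q >= c h^(1 + q/p')]
    ([weight_integral_lower]), and
    [1 + q/p' = q (1 - sigma) <= q <= 2 - mu] while [h <= T]. *)

Set Implicit Arguments.
Unset Strict Implicit.
Unset Printing Implicit Defensive.

Import Order.TTheory GRing.Theory Num.Theory.
Import numFieldNormedType.Exports.

Local Open Scope classical_set_scope.
Local Open Scope ring_scope.

(** * Integrals of the Riemann-Liouville kernel *)

Lemma is_derive_powR_sub (R : realType) (e b x : R) : 0 < e -> x < b ->
  is_derive x (1 : R) (fun y : R => - ((b - y) `^ e / e)) ((b - x) `^ (e - 1)).
Proof.
move=> e0 xb.
have bx : (b - x) \in `]0, +oo[ by rewrite in_itv/= andbT subr_gt0.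
have d1 : is_derive (b - x) (1 : R) (@powR R ^~ e) (e * (b - x) `^ (e - 1)).
  apply: DeriveDef; first exact: derivable_powR.
  by rewrite -derive1E powR_derive1.
have d2 : is_derive x (1 : R) (fun y => b - y) (-1).
  by apply: is_derive_eq; rewrite add0r mul1r.
have d3 := @is_derive1_comp R (@powR R ^~ e) (fun y : R => b - y) x _ _ d1 d2.
rewrite (_ : (fun y => _) = (- e^-1) \*: ((@powR R ^~ e) \o (fun y => b - y))); last first.
  by apply/funext => y /=; rewrite -[_ *: _]/(_ * _) mulNr mulrC.
apply: is_derive_eq; rewrite -[_ *: _]/(_ * _).
by field; rewrite gt_eqF.
Qed.

(** For [e < 1] the integrand blows up at [b]: the fundamental theorem of
    calculus is applied on [[a, c n]] with [c n] increasing to [b], and monotone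
    convergence gives the limit. *)
Lemma integral_powR_sub (R : realType) (e a b : R) : 0 < e -> a < b ->
  (\int[@lebesgue_measure R]_(x in `]a, b[) ((b - x) `^ (e - 1))%:E
   = ((b - a) `^ e / e)%:E)%E.
Proof.
move=> e0 ab.
pose c n : R := b - (b - a) / n.+2%:R.
have ba : 0 < b - a by rewrite subr_gt0.
have ltac n : a < c n.
  rewrite /c ltrBrDl -ltrBrDr ltr_pdivrMr// ltr_pMr// ltr1n//.
have ltcb n : c n < b.
  by rewrite /c ltrBlDr ltrDl divr_gt0.
have FTC n : (\int[@lebesgue_measure R]_(x in `[a, c n]) ((b - x) `^ (e - 1))%:E
   = ((b - a) `^ e / e - ((b - a) / n.+2%:R) `^ e / e)%:E)%E.
  pose F y : R := - ((b - y) `^ e / e).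
  have dF x : x <= c n -> is_derive x (1 : R) F ((b - x) `^ (e - 1)).
    by move=> xc; apply: is_derive_powR_sub => //; exact: le_lt_trans (ltcb n).
  have cF x : x <= c n -> {for x, continuous F}.
    move=> xc; apply/differentiable_continuous/derivable1_diffP.
    by have [] := dF x xc.
  rewrite (@continuous_FTC2 R _ F)//.
  - rewrite -EFinD /F; congr (_%:E).
    by rewrite opprK addrC /c opprB addrCA subrr addr0.
  - apply: continuous_in_subspaceT => x; rewrite inE/= in_itv/= => /andP[_ xc].
    have bx : 0 < b - x by rewrite subr_gt0; exact: le_lt_trans (ltcb n).
    apply: (@continuous_comp _ _ _ (fun y => b - y) (@powR R ^~ (e - 1))).
      by apply: cvgB; [exact: cvg_cst|exact: cvg_id].
    apply/differentiable_continuous/derivable1_diffP.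
    by apply: derivable_powR; rewrite in_itv/= andbT.
  - split.
    + move=> x; rewrite in_itv/= => /andP[_ xc].
      by have [] := dF x (ltW xc).
    + by apply: cvg_at_right_filter; apply: cF; exact: ltW.
    + by apply: cvg_at_left_filter; apply: cF.
  - move=> x; rewrite in_itv/= => /andP[_ xc].
    by have [_ <-] := dF x (ltW xc); rewrite derive1E.
have U : \bigcup_n `[a, c n]%classic = `[a, b[%classic :> set R.
  apply/seteqP; split => x /=.
    move=> [n _] /=; rewrite !in_itv/= => /andP[-> xc] /=.
    exact: le_lt_trans (ltcb n).
  rewrite in_itv/= => /andP[ax xb].
  have bx : 0 < b - x by rewrite subr_gt0.
  exists (Num.truncn ((b - a) / (b - x))) => //=; rewrite in_itv/= ax/= /c.
  rewrite lerBrDl -lerBrDr ler_pdivrMr// mulrC -ler_pdivrMr//.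
  apply: ltW; apply: lt_le_trans (truncnS_gt _) _.
  by rewrite ler_nat.
have mf (A : set R) : measurable_fun A (fun x : R => (b - x) `^ (e - 1)).
  apply: measurable_funTS.
  apply: (measurableT_comp (measurable_powR _)) => //.
  exact: measurable_funB.
rewrite -(integral_itv_bndoo true true); last exact/measurable_EFinP.
have cvI : (\int[@lebesgue_measure R]_(x in `[a, c n]) ((b - x) `^ (e - 1))%:E)%E
    @[n --> \oo] --> (\int[@lebesgue_measure R]_(x in `[a, b[) ((b - x) `^ (e - 1))%:E)%E.
  rewrite -U; apply: (@ge0_nondecreasing_set_cvg_integral _ (measurableTypeR R)) => //.
  - move=> m n mn; rewrite subsetEset => x /=; rewrite !in_itv/= => /andP[-> xm]/=.
    apply: (le_trans xm); rewrite /c lerB// ler_wpM2l//; first exact: ltW.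
    rewrite lef_pV2 ?posrE ?ltr0n// ler_nat; exact: mn.
  - by move=> n; apply/measurable_EFinP; exact: mf.
  - by move=> n x _; rewrite lee_fin powR_ge0.
move: cvI; under eq_fun do rewrite FTC.
move=> /cvg_unique; apply => //.
apply: cvg_EFin; first exact: nearW.
rewrite -[X in _ --> X]subr0; apply: cvgB; first exact: cvg_cst.
rewrite -[X in _ --> X](mul0r e^-1); apply: cvgM; last exact: cvg_cst.
have /cvg_at_rightP := @powR_cvg0 R e e0; apply; split.
  by move=> n; rewrite divr_gt0.
rewrite -[X in _ --> X](mulr0 (b - a)); apply: cvgM; first exact: cvg_cst.
by have := @cvg_harmonic R; rewrite -(cvg_shiftS (@harmonic R)).
Qed.

Section ge0_real_integral.
Variables (R : realType) (D : set R) (f g : R -> R).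
Hypotheses (mD : measurable D) (mf : measurable_fun D f)
  (f0 : forall x, D x -> 0 <= f x).
Local Notation mu := (@lebesgue_measure R).

Lemma le_integral_EFin : measurable_fun D g -> (forall x, D x -> f x <= g x) ->
  (\int[mu]_(x in D) (f x)%:E <= \int[mu]_(x in D) (g x)%:E)%E.
Proof.
move=> mg fg; apply: ge0_le_integral => //; exact/measurable_EFinP.
Qed.

Lemma integralZ_EFin k : 0 <= k ->
  (\int[mu]_(x in D) (k * f x)%:E = k%:E * \int[mu]_(x in D) (f x)%:E)%E.
Proof.
move=> k0; under eq_integral do rewrite EFinM.
by rewrite ge0_integralZl_EFin//; exact/measurable_EFinP.
Qed.

Lemma ge0_integralD_EFin : measurable_fun D g -> (forall x, D x -> 0 <= g x) ->
  (\int[mu]_(x in D) (f x + g x)%:E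
   = \int[mu]_(x in D) (f x)%:E + \int[mu]_(x in D) (g x)%:E)%E.
Proof.
move=> mg g0; under eq_integral do rewrite EFinD.
by rewrite ge0_integralD//; exact/measurable_EFinP.
Qed.

End ge0_real_integral.

(** Extending the kernel by zero beyond [t] lets all the values of a fractional
    integral be integrals over one fixed interval.  The test is needed because a
    negative base raised to any power is [1]. *)
Definition rl_kernel (R : realType) (alpha t tau : R) : R :=
  if tau < t then (t - tau) `^ (alpha - 1) else 0.

Lemma rl_kernel_ge0 (R : realType) (alpha t tau : R) :
  0 <= rl_kernel alpha t tau.
Proof. by rewrite /rl_kernel; case: ifP => // _; exact: powR_ge0. Qed.

Lemma measurable_rl_kernel (R : realType) (alpha t : R) (A : set R) :
  measurable_fun A (rl_kernel alpha t).
Proof.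
apply: measurable_funTS; apply: measurable_fun_ifT => //.
- exact: measurable_fun_ltr.
- apply: (measurableT_comp (measurable_powR _)) => //.
  exact: measurable_funB.
Qed.

Lemma integral_supported (R : realType) (D A : set R) (f h : R -> \bar R) :
  A `<=` D -> (forall x, A x -> f x = h x) ->
  (forall x, D x -> ~ A x -> f x = 0%E) ->
  (\int[@lebesgue_measure R]_(x in D) f x
   = \int[@lebesgue_measure R]_(x in A) h x)%E.
Proof.
move=> AD fh f0; rewrite -[A in RHS](_ : D `&` A = A); last exact/setIidPr.
rewrite [RHS]integral_mkcondr.
apply: eq_integral => x /[!inE] Dx; rewrite patchE.
have [xA|xA] := pselect (A x); [by rewrite mem_set// fh|by rewrite memNset// f0].
Qed.

Lemma integral_rl_kernel_powR (R : realType) (T alpha r s t : R) :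
  0 < r -> 0 < (alpha - 1) * r + 1 -> s < t -> t <= T ->
  (\int[@lebesgue_measure R]_(x in `]s, T[) ((rl_kernel alpha t x) `^ r)%:E
   = ((t - s) `^ ((alpha - 1) * r + 1) / ((alpha - 1) * r + 1))%:E)%E.
Proof.
move=> r0 e0 st tT; rewrite -(integral_powR_sub e0 st).
apply: integral_supported => x.
- by rewrite /= !in_itv/= => /andP[-> xt]; rewrite (lt_le_trans xt tT).
- by rewrite /= in_itv/= => /andP[_ xt]; rewrite /rl_kernel xt addrK powRrM.
- rewrite /= !in_itv/= /rl_kernel => /andP[-> _]; case: ifPn => //= _ _.
  by rewrite powR0// gt_eqF.
Qed.

Lemma powR_superadditive (R : realType) (r x y : R) :
  1 <= r -> 0 <= y <= x -> (x - y) `^ r + y `^ r <= x `^ r.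
Proof.
move=> r1 /andP[y0 yx]; have x0 := le_trans y0 yx.
have r0 : 0 < r by exact: lt_le_trans r1.
have xy0 : 0 <= x - y by rewrite subr_ge0.
rewrite -(mulr_powRB1 xy0 r0) -(mulr_powRB1 y0 r0) -(mulr_powRB1 x0 r0).
rewrite [leRHS](_ : _ = (x - y) * x `^ (r - 1) + y * x `^ (r - 1)); last by ring.
by apply: lerD; apply: ler_wpM2l => //; apply: ge0_ler_powR;
  rewrite ?nnegrE ?subr_ge0// gerBl.
Qed.

(** Let [k_t] be the kernel at [t] and [e = (alpha - 1) r + 1].  Superadditivity
    of the [r]-th power turns the distance into a difference of [r]-th powers:
    [|k_t - k_s|^r + k_t^r <= k_s^r + 2 g^r], where [g] is [k_t] on [[s, T)]
    and [0] elsewhere.  The integrals of [k_t^r] and [k_s^r] over [(0,T)] are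
    [t^e / e >= s^e / e], so only the integral of [2 g^r] survives. *)
Lemma integral_rl_kernel_diff (R : realType) (T alpha r s t : R) :
  1 <= r -> alpha < 1 -> 0 < (alpha - 1) * r + 1 -> 0 < s -> s < t -> t < T ->
  (\int[@lebesgue_measure R]_(x in `]0%R, T[)
     (`|rl_kernel alpha t x - rl_kernel alpha s x| `^ r)%:E
   <= (2 * ((t - s) `^ ((alpha - 1) * r + 1) / ((alpha - 1) * r + 1)))%:E)%E.
Proof.
move=> r1 a1; set e := _ + 1 => e0 s0 st tT.
have r0 : 0 < r by exact: lt_le_trans r1.
have mk u (A : set R) : measurable_fun A (fun x : R => (rl_kernel alpha u x) `^ r).
  apply: (measurableT_comp (measurable_powR _)); exact: measurable_rl_kernel.
have md : measurable_fun `]0%R, T[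
    (fun x : R => `|rl_kernel alpha t x - rl_kernel alpha s x| `^ r).
  apply: (measurableT_comp (measurable_powR _)).
  apply: measurableT_comp => //.
  by apply: measurable_funB; exact: measurable_rl_kernel.
pose g x : R := if x < s then 0 else rl_kernel alpha t x.
have mg : measurable_fun `]0%R, T[ (fun x : R => (g x) `^ r).
  apply: (measurableT_comp (measurable_powR _)); rewrite /g.
  apply: measurable_funTS; apply: measurable_fun_ifT => //.
    exact: measurable_fun_ltr.
  exact: measurable_rl_kernel.
have m2g : measurable_fun `]0%R, T[ (fun x : R => 2 * (g x) `^ r).
  by apply: measurable_funM => //; exact: mg.
have Ik u : 0 < u <= T -> (\int[@lebesgue_measure R]_(x in `]0%R, T[)
    ((rl_kernel alpha u x) `^ r)%:E = (u `^ e / e)%:E)%E.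
  move=> /andP[u0 uT].
  by rewrite (integral_rl_kernel_powR r0 e0 u0 uT) subr0.
have Ig : (\int[@lebesgue_measure R]_(x in `]0%R, T[) ((g x) `^ r)%:E
    = ((t - s) `^ e / e)%:E)%E.
  rewrite -(integral_rl_kernel_powR r0 e0 st (ltW tT)).
  rewrite -(integral_itv_bndoo true true); last first.
    by apply/measurable_EFinP; exact: mk.
  apply: integral_supported => x; rewrite /= ?in_itv/= /g.
  - by move=> /andP[sx ->]; rewrite (lt_le_trans s0 sx).
  - by move=> /andP[sx _]; rewrite ltNge sx.
  - by move=> /andP[_ ->]; rewrite andbT => /negP; rewrite -ltNge => ->; rewrite powR0 ?gt_eqF.
have key : (\int[@lebesgue_measure R]_(x in `]0%R, T[)
     (`|rl_kernel alpha t x - rl_kernel alpha s x| `^ r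
      + (rl_kernel alpha t x) `^ r)%:E
  <= \int[@lebesgue_measure R]_(x in `]0%R, T[)
     ((rl_kernel alpha s x) `^ r + 2 * (g x) `^ r)%:E)%E.
  apply: le_integral_EFin => //.
  - by apply: measurable_funD; [exact: md|exact: mk].
  - by move=> x _; rewrite addr_ge0// powR_ge0.
  - apply: measurable_funD; first exact: mk.
    exact: m2g.
  - move=> x _.
    rewrite /g; case: ltP => sx.
      (* The exponent alpha - 1 is negative: the kernel decreases in t. *)
      have kts : rl_kernel alpha t x <= rl_kernel alpha s x.
        rewrite /rl_kernel sx (lt_trans sx st) -(opprB 1 alpha) !powRN.
        have sx0 : 0 < s - x by rewrite subr_gt0.
        have tx0 : 0 < t - x by rewrite subr_gt0 (lt_trans sx st).
        rewrite lef_pV2 ?posrE ?powR_gt0//.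
        apply: ge0_ler_powR; rewrite ?nnegrE ?subr_ge0 ?(ltW a1) ?(ltW sx)//.
          by rewrite ltW// (lt_trans sx).
        by rewrite lerB// ltW.
      rewrite powR0 ?gt_eqF// mulr0 addr0 ler0_norm ?subr_le0// opprB.
      by apply: powR_superadditive => //; rewrite rl_kernel_ge0.
    have -> : rl_kernel alpha s x = 0 by rewrite /rl_kernel ltNge sx.
    rewrite subr0 powR0 ?gt_eqF// add0r.
    by rewrite ger0_norm ?rl_kernel_ge0// mulr_natl mulr2n.
rewrite !ge0_integralD_EFin// ?integralZ_EFin// in key;
  try by [exact: mk|exact: m2g|move=> x _; rewrite ?mulr_ge0// powR_ge0].
have hs : 0 < s <= T by rewrite s0 (ltW (lt_trans st tT)).
have ht : 0 < t <= T by rewrite (lt_trans s0 st) ltW.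
have cancel (A B C G : \bar R) (b c d : R) : (A + B <= C + 2%:E * G)%E ->
    B = b%:E -> C = c%:E -> G = d%:E -> c <= b -> (A <= (2 * d)%:E)%E.
  move=> ABCG Bb Cc Gd cb; move: ABCG; rewrite Bb Cc Gd.
  move=> /le_trans - /(_ (b + 2 * d)%:E).
  rewrite -EFinM -EFinD lee_fin lerD2r => /(_ cb).
  by rewrite [b + _]addrC [X in (_ <= X)%E]EFinD leeD2rE.
apply: (cancel _ _ _ _ _ _ _ key (Ik t ht) (Ik s hs) Ig).
rewrite ler_pM2r ?invr_gt0// ge0_ler_powR ?nnegrE ?ltW//.
exact: lt_trans st.
Qed.

(** * The fractional integral on a ball of L^p *)

Lemma conj_expP (R : realType) (p : R) : 1 < p ->
  1 < conj_exp p /\ p^-1 + (conj_exp p)^-1 = 1.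
Proof.
move=> p1; have p10 : 0 < p - 1 by rewrite subr_gt0.
split; first by rewrite /conj_exp ltr_pdivlMr// mul1r gtrBl.
by rewrite /conj_exp; field; rewrite !gt_eqF//= (lt_trans ltr01).
Qed.

(** The free parameter [s] moves weight between the two terms; it replaces the
    optimisation hidden in Hoelder's inequality. *)
Lemma scaled_young (R : realType) (p x y s : R) :
  1 < p -> 0 <= x -> 0 <= y -> 0 < s ->
  x * y <= s `^ p * x `^ p + s^-1 `^ conj_exp p * y `^ conj_exp p.
Proof.
move=> p1 x0 y0 s0; have [r1 pr] := conj_expP p1.
have p0 : 0 < p by exact: lt_trans p1.
have r0 : 0 < conj_exp p by exact: lt_trans r1.
have si0 : 0 <= s^-1 by rewrite invr_ge0 ltW.
have -> : x * y = (s * x) * (s^-1 * y) by field; rewrite gt_eqF.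
have := conjugate_powR (mulr_ge0 (ltW s0) x0) (mulr_ge0 si0 y0) p0 r0 pr.
rewrite !powRM ?(ltW s0)// => /le_trans; apply.
by apply: lerD; rewrite ler_pdivrMr// ler_peMr ?mulr_ge0 ?powR_ge0// ltW.
Qed.

(** The scaled Young inequality, integrated: a bound of Hoelder type that also
    yields integrability of the product. *)
Lemma pairing_bound (R : realType) (D : set R) (u d : R -> R) (p N M s : R) :
  measurable D -> measurable_fun D u -> measurable_fun D d -> 1 < p -> 0 < s ->
  (\int[@lebesgue_measure R]_(x in D) (`|u x| `^ p)%:E <= N%:E)%E ->
  (\int[@lebesgue_measure R]_(x in D) (`|d x| `^ conj_exp p)%:E <= M%:E)%E ->
  (@lebesgue_measure R).-integrable D (fun x => (u x * d x)%:E) /\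
  `|\int[@lebesgue_measure R]_(x in D) (u x * d x)|
    <= s `^ p * N + s^-1 `^ conj_exp p * M.
Proof.
move=> mD mu md p1 s0 uN dM.
have mpow (f : R -> R) r : measurable_fun D f ->
    measurable_fun D (fun x => `|f x| `^ r).
  move=> mf; apply: (measurableT_comp (measurable_powR _)).
  exact: measurableT_comp.
have mud : measurable_fun D (fun x => u x * d x) by exact: measurable_funM.
have I : (\int[@lebesgue_measure R]_(x in D) `|(u x * d x)%:E|
    <= (s `^ p * N + s^-1 `^ conj_exp p * M)%:E)%E.
  apply: (@le_trans _ _ (\int[@lebesgue_measure R]_(x in D)
     (s `^ p * `|u x| `^ p + s^-1 `^ conj_exp p * `|d x| `^ conj_exp p)%:E)%E).
    apply: le_integral_EFin => //.
    - exact: measurableT_comp.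
    - by apply: measurable_funD; apply: measurable_funM => //; exact: mpow.
    - by move=> x _; rewrite normrM; exact: scaled_young.
  rewrite ge0_integralD_EFin//; first last.
  - by move=> x _; rewrite mulr_ge0 ?powR_ge0.
  - by apply: measurable_funM => //; exact: mpow.
  - by move=> x _; rewrite mulr_ge0 ?powR_ge0.
  - by apply: measurable_funM => //; exact: mpow.
  rewrite !integralZ_EFin ?powR_ge0//;
    try by [exact: mpow|move=> x _; exact: powR_ge0].
  by rewrite EFinD !EFinM; apply: leeD; apply: lee_wpmul2l => //;
    rewrite lee_fin powR_ge0.
have iud : (@lebesgue_measure R).-integrable D (fun x => (u x * d x)%:E).
  apply/integrableP; split; first exact/measurable_EFinP.
  by apply: le_lt_trans I _; rewrite ltry.
split => //.
have := @le_normr_Rintegral _ _ _ (@lebesgue_measure R) D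
  (fun x => u x * d x) mD iud.
move=> /le_trans; apply.
rewrite -lee_fin fineK//; rewrite ge0_fin_numE; last exact: integral_ge0.
exact: le_lt_trans I (ltry _).
Qed.

Section fractional_integral.
Variables (R : realType) (T p alpha N : R).
Hypotheses (T0 : 0 < T) (p1 : 1 < p) (pa : p^-1 < alpha) (a1 : alpha < 1).
Local Notation mu := (@lebesgue_measure R).
Local Notation r := (conj_exp p).
Local Notation e := ((alpha - 1) * r + 1).

(** For [N >= 0], the closed ball of [L^p(0,T)] of radius [N^(1/p)]. *)
Definition Lp_ball (u : R -> R) : Prop :=
  measurable_fun `]0, T[ u
  /\ (\int[mu]_(x in `]0%R, T[) (`|u x| `^ p)%:E <= N%:E)%E.

Let e0 : 0 < e.
Proof.
have [r1 pr] := conj_expP p1; have r0 : 0 < r by exact: lt_trans r1.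
have eE : e = r * (alpha - p^-1).
  have -> : p^-1 = 1 - r^-1 by rewrite -pr addrK.
  by field; rewrite gt_eqF.
by rewrite eE mulr_gt0// subr_gt0.
Qed.

Let r0 : 0 < r.
Proof. by have [r1 _] := conj_expP p1; exact: lt_trans r1. Qed.

Let mI : measurable (`]0, T[%classic : set R). Proof. by []. Qed.

Let mk (t : R) : measurable_fun `]0, T[ (rl_kernel alpha t).
Proof. exact: measurable_rl_kernel. Qed.

Let integral_kernel (t : R) : 0 < t < T ->
  (\int[mu]_(x in `]0%R, T[) (`|rl_kernel alpha t x| `^ r)%:E
   <= (T `^ e / e)%:E)%E.
Proof.
move=> /andP[t0 tT]; under eq_integral do rewrite ger0_norm ?rl_kernel_ge0//.
rewrite integral_rl_kernel_powR ?(ltW tT)// subr0 lee_fin.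
by rewrite ler_pM2r ?invr_gt0// ge0_ler_powR ?nnegrE ?ltW.
Qed.

Lemma integrable_rl_kernel u (t : R) : Lp_ball u -> 0 < t < T ->
  mu.-integrable `]0, T[ (fun x => (u x * rl_kernel alpha t x)%:E).
Proof.
move=> [mu uN] tT.
by have [] := pairing_bound mI mu (mk t) p1 ltr01 uN (integral_kernel tT).
Qed.

Lemma frac_kernelE u (t x : R) : x < t ->
  frac_kernel alpha u t x = u x * rl_kernel alpha t x.
Proof.
by move=> xt; rewrite /frac_kernel /rl_kernel xt -(opprB 1 alpha) powRN.
Qed.

Lemma integrable_frac_kernel u (t : R) : Lp_ball u -> 0 < t < T ->
  mu.-integrable `]0, t[ (fun x => (frac_kernel alpha u t x)%:E).
Proof.
move=> uN tT; have /andP[t0 ltT] := tT.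
have I : mu.-integrable `]0, t[ (fun x => (u x * rl_kernel alpha t x)%:E).
  apply: integrableS (integrable_rl_kernel uN tT) => //.
  by apply: subset_itvl; rewrite bnd_simp ltW.
apply: eq_integrable I => //.
by move=> x /[!inE]/=; rewrite in_itv/= => /andP[_ xt]; rewrite frac_kernelE.
Qed.

Lemma frac_intE u (t : R) : 0 < t < T -> frac_int T alpha u t =
  (Gamma alpha)^-1 * \int[mu]_(x in `]0, T[) (u x * rl_kernel alpha t x).
Proof.
move=> tT; have /andP[t0 ltT] := tT.
rewrite /frac_int indicE mem_set/= ?in_itv//= mul1r; congr (_ * fine _).
symmetry; apply: integral_supported => x; rewrite /= !in_itv/=.
- by move=> /andP[-> xt]; rewrite (lt_trans xt).
- by move=> /andP[_ xt]; rewrite frac_kernelE.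
- move=> /andP[-> _]/= /negP; rewrite /rl_kernel => /negbTE ->.
  by rewrite mulr0.
Qed.

Lemma frac_int_bounded : exists M : R, forall u (t : R), Lp_ball u -> 0 < t < T ->
  `|frac_int T alpha u t| <= M.
Proof.
exists (`|(Gamma alpha)^-1| * (1 `^ p * N + 1^-1 `^ r * (T `^ e / e))).
move=> u t [mu uN] tT.
rewrite frac_intE// normrM ler_wpM2l//.
by have [] := pairing_bound mI mu (mk t) p1 ltr01 uN
  (integral_kernel tT).
Qed.

Lemma frac_int_diff u (s t c : R) : Lp_ball u ->
  0 < s -> s < t -> t < T -> 0 < c ->
  `|frac_int T alpha u t - frac_int T alpha u s| <=
  `|(Gamma alpha)^-1| * (c `^ p * N + c^-1 `^ r * (2 * ((t - s) `^ e / e))).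
Proof.
move=> uN s0 st tT c0; have [r1 _] := conj_expP p1.
have hs : 0 < s < T by rewrite s0 (lt_trans st).
have ht : 0 < t < T by rewrite (lt_trans s0 st).
rewrite !frac_intE// -mulrBr normrM ler_wpM2l// -RintegralB//; last 2 first.
- exact: integrable_rl_kernel.
- exact: integrable_rl_kernel.
under eq_Rintegral do rewrite -mulrBr.
have md : measurable_fun `]0, T[
    (fun x : R => rl_kernel alpha t x - rl_kernel alpha s x).
  by apply: measurable_funB; exact: measurable_rl_kernel.
have [mu uN'] := uN.
by have [] := pairing_bound mI mu md p1 c0 uN'
  (integral_rl_kernel_diff (ltW r1) a1 e0 s0 st tT).
Qed.

(** In [frac_int_diff] the parameter [c] is first taken so small that the term
    with [N] contributes at most half of [eps], uniformly in [u]; the other term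
    then tends to zero with [t - s], since [e > 0]. *)
Lemma frac_int_equicontinuous (eps : R) : 0 < eps -> exists2 delta : R, 0 < delta &
  forall u (s t : R), Lp_ball u -> 0 < s < T -> 0 < t < T -> `|s - t| < delta ->
  `|frac_int T alpha u s - frac_int T alpha u t| <= eps.
Proof.
move=> eps0.
(* Adding 1 makes both constants positive, hence invertible. *)
pose G : R := `|(Gamma alpha)^-1| + 1.
pose N1 : R := `|N| + 1.
have G0 : 0 < G by rewrite ltr_wpDl.
have N10 : 0 < N1 by rewrite ltr_wpDl.
have p0 : 0 < p by exact: lt_trans p1.
pose c : R := (eps / (2 * G * N1)) `^ p^-1.
have c0 : 0 < c by rewrite powR_gt0// divr_gt0// !mulr_gt0.
pose k : R := c^-1 `^ r * 2 / e.
have k0 : 0 < k by rewrite divr_gt0// mulr_gt0// powR_gt0// invr_gt0.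
pose delta : R := (eps / (2 * G * k)) `^ e^-1.
have Gk0 : 0 < 2 * G * k by apply: (mulr_gt0 _ k0); exact: mulr_gt0.
have d0 : 0 < delta by apply/powR_gt0/divr_gt0.
exists delta => //.
suff main u s t : Lp_ball u -> 0 < s -> s < t -> t < T -> t - s < delta ->
    `|frac_int T alpha u t - frac_int T alpha u s| <= eps.
  move=> u s t uN /andP[s0 sT] /andP[t0 tT].
  case: (ltgtP s t) => [st|ts|->].
  - by rewrite ltr0_norm ?subr_lt0// opprB distrC; exact: main.
  - by rewrite gtr0_norm ?subr_gt0//; exact: main.
  - by rewrite !subrr normr0 ltW.
move=> uN s0 st tT std; apply: (le_trans (frac_int_diff uN s0 st tT c0)).
have cN : c `^ p * N <= eps / (2 * G).
  rewrite /c -powRrM mulVf ?gt_eqF// powRr1; last by rewrite divr_ge0 ?mulr_ge0 ?ltW.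
  apply: (@le_trans _ _ (eps / (2 * G * N1) * N1)).
    apply: ler_wpM2l; first by rewrite divr_ge0 ?mulr_ge0 ?ltW.
    by rewrite (le_trans (ler_norm N))// lerDl.
  by rewrite le_eqVlt; apply/orP; left; apply/eqP; field; rewrite !gt_eqF.
have kN : c^-1 `^ r * (2 * ((t - s) `^ e / e)) <= eps / (2 * G).
  rewrite (_ : _ * _ = k * (t - s) `^ e); last by rewrite /k; ring.
  have : (t - s) `^ e <= delta `^ e.
    by apply: ge0_ler_powR; rewrite ?nnegrE ?(ltW e0) ?subr_ge0 ?powR_ge0 ?ltW.
  rewrite /delta -powRrM mulVf ?(gt_eqF e0)// powRr1; last by apply: divr_ge0; exact: ltW.
  move=> /(ler_wpM2l (ltW k0)) /le_trans; apply.
  rewrite le_eqVlt; apply/orP; left; apply/eqP; field.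
  by rewrite (gt_eqF k0) (gt_eqF G0).
apply: (@le_trans _ _ (G * (eps / (2 * G) + eps / (2 * G)))).
  apply: le_trans (_ : `|(Gamma alpha)^-1| * (eps / (2 * G) + eps / (2 * G)) <= _).
    by rewrite ler_wpM2l// lerD.
  by rewrite ler_wpM2r ?lerDl// addr_ge0// divr_ge0 ?mulr_ge0 ?ltW.
by rewrite le_eqVlt; apply/orP; left; apply/eqP; field; rewrite !gt_eqF.
Qed.

Lemma frac_int_linear (a : R) u v (t : R) :
  Lp_ball u -> Lp_ball v -> 0 < t < T ->
  frac_int T alpha (fun x => a * u x + v x) t
  = a * frac_int T alpha u t + frac_int T alpha v t.
Proof.
move=> uN vN tT; rewrite !frac_intE// [a * _]mulrCA -mulrDr; congr (_ * _).
have Iu := integrable_rl_kernel uN tT; have Iv := integrable_rl_kernel vN tT.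
rewrite -RintegralZl// -RintegralD//; last first.
  have : mu.-integrable `]0, T[
      (fun x => a%:E * (u x * rl_kernel alpha t x)%:E)%E.
    exact: integrableZl.
  by apply: eq_integrable => // x _; rewrite -EFinM.
by apply: eq_Rintegral => x _; rewrite mulrDl mulrA.
Qed.

End fractional_integral.

(** * Compactness of equicontinuous sequences *)

Lemma ultra_bounded_cvg (R : realType) (I : Type) (U : set_system I) (f : I -> R)
    (M : R) : UltraFilter U -> (forall i, `|f i| <= M) ->
  exists2 l : R, `|l| <= M & f i @[i --> U] --> l.
Proof.
move=> UU fM.
have cM : compact (`[- M, M]%classic : set R) by exact: segment_compact.
have [|l [lM cl]] := cM (f @ U) _.
  apply: (@filterS _ U _ setT) => [i _|]; last exact: filterT.
  by rewrite /= in_itv/= -ler_norml.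
exists l; first by move: lM; rewrite /= in_itv/= -ler_norml.
move=> B lB; have [//|UB] := in_ultra_setVsetC (f @^-1` B) UU.
by have [y []] := cl (~` B) B UB lB.
Qed.

(** A free ultrafilter on the indices replaces the diagonal argument: it
    provides all the pointwise limits at once.  Equicontinuity makes the
    convergence locally uniform, and compactness of [[a, b]] makes it uniform
    on [A].  Every set of the ultrafilter is infinite, so the subsequence can
    be picked one index after the other. *)
Lemma ascoli_sequence (R : realType) (a b M : R) (A : set R) (v : nat -> R -> R) :
  A `<=` `[a, b] -> (forall n x, A x -> `|v n x| <= M) ->
  (forall eps : R, 0 < eps -> exists2 delta : R, 0 < delta & forall n x y,
     A x -> A y -> `|x - y| < delta -> `|v n x - v n y| <= eps) ->
  exists (phi : nat -> nat) (g : R -> R),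
    [/\ forall m n, (m < n)%N -> (phi m < phi n)%N,
        forall x, A x -> `|g x| <= M,
        forall eps : R, 0 < eps -> exists2 delta : R, 0 < delta & forall x y,
          A x -> A y -> `|x - y| < delta -> `|g x - g y| <= eps
      & forall n x, A x -> `|v (phi n) x - g x| <= n.+1%:R^-1].
Proof.
move=> Aab vM equi.
have [U [UU ooU]] := ultraFilterLemma (_ : ProperFilter \oo%classic).
have /choice[g gP] : forall x, exists l, A x -> `|l| <= M /\ v n x @[n --> U] --> l.
  move=> x; have [Ax|] := pselect (A x); last by exists 0.
  by have [l lM vl] := ultra_bounded_cvg UU (fun n => vM n x Ax); exists l.
have gcl (eps x : R) : 0 < eps -> A x -> \forall n \near U, `|v n x - g x| <= eps.
  move=> eps0 Ax; have [_ /cvgrPdist_le/(_ _ eps0)] := gP x Ax.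
  by apply: filterS => n; rewrite distrC.
have gequi (eps : R) : 0 < eps -> exists2 delta : R, 0 < delta & forall x y,
    A x -> A y -> `|x - y| < delta -> `|g x - g y| <= eps.
  move=> eps0; have eps3 : 0 < eps / 3 by rewrite divr_gt0.
  have [delta d0 dP] := equi _ eps3; exists delta => // x y Ax Ay xy.
  have [n [nx ny]] : exists n,
      `|v n x - g x| <= eps / 3 /\ `|v n y - g y| <= eps / 3.
    by apply: (@filter_ex _ U); apply: filterI; exact: gcl.
  have := dP n x y Ax Ay xy; move: nx ny; rewrite !ler_norml; lra.
have unif (eps : R) : 0 < eps ->
    \forall n \near U, forall x, A x -> `|v n x - g x| <= eps.
  move=> eps0; have eps3 : 0 < eps / 3 by rewrite divr_gt0.
  have [d1 d10 d1P] := equi _ eps3; have [d2 d20 d2P] := gequi _ eps3.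
  have /compact_near_coveringP cov : compact (`[a, b]%classic : set R).
    exact: segment_compact.
  have := cov nat U (fun n x => A x -> `|v n x - g x| <= eps).
  have loc x : `[a, b]%classic x ->
      \forall x' \near x & n \near U, A x' -> `|v n x' - g x'| <= eps.
    (* A need not be dense near x, so the reference point is any y of A that
       is close to x; without one there is nothing to prove. *)
    move=> _; pose d := Num.min d1 d2 / 2.
    have d0 : 0 < d by rewrite divr_gt0// lt_min d10.
    have [[y [Ay xy]]|noy] := pselect (exists y, A y /\ `|x - y| < d); last first.
      exists (ball x d, setT) => /=.
        by split; [exact: nbhsx_ballx|exact: filterT].
      by move=> [x' n] /= [xx' _] Ax'; exfalso; apply: noy; exists x'.
    exists (ball x d, [set n | `|v n y - g y| <= eps / 3]) => /=.
      by split; [exact: nbhsx_ballx|exact: gcl].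
    move=> [x' n] /= [xx' ny] Ax'.
    have x'y : `|x' - y| < Num.min d1 d2.
      rewrite (splitr (Num.min d1 d2)) -/d -(subrKA x) (le_lt_trans (ler_normD _ _))//.
      by rewrite ltrD// distrC.
    move: x'y; rewrite lt_min => /andP[x'y1 x'y2].
    have := d1P n _ _ Ax' Ay x'y1; have := d2P _ _ Ax' Ay x'y2.
    move: ny; rewrite !ler_norml; lra.
  move=> /(_ _ loc); apply: filterS => n /= H x Ax.
  by apply: H => //; exact: Aab.
have /choice[nxt nxtP] : forall km : nat * nat, exists n, (km.2 < n)%N /\
    forall x, A x -> `|v n x - g x| <= km.1.+1%:R^-1.
  move=> [k m] /=; apply: (@filter_ex _ U); apply: filterI; last exact: unif.
  by apply: ooU; exists m.+1.
pose phi := fix phi k := if k is k'.+1 then nxt (k, phi k') else nxt (0, 0)%N.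
exists phi, g; split => //.
- apply: (homo_ltn ltn_trans) => k /=.
  exact: (nxtP (k.+1, phi k)).1.
- by move=> x Ax; exact: (gP x Ax).1.
- by case=> [|k] x Ax; [exact: (nxtP (0, 0)%N).2|exact: (nxtP (k.+1, phi k)).2].
Qed.

Lemma uniformly_continuous_measurable (R : realType) (a b : R) (f : R -> R) :
  (forall eps : R, 0 < eps -> exists2 delta : R, 0 < delta & forall x y,
     `]a, b[%classic x -> `]a, b[%classic y -> `|x - y| < delta ->
     `|f x - f y| <= eps) ->
  measurable_fun `]a, b[ f.
Proof.
move=> uc; apply: open_continuous_measurable_fun; first exact: interval_open.
move=> x /[!inE] xab; apply/cvgrPdist_le => eps eps0.
have [delta d0 dP] := uc _ eps0.
have Nx : nbhs x (`]a, b[%classic : set R).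
  by apply: open_nbhs_nbhs; split => //; exact: interval_open.
apply: filterS (filterI Nx (nbhsx_ballx x _ d0)) => y [yab xy].
exact: dP.
Qed.

(** * Integrals of weights in A_plus *)

Section weights.
Variables (R : realType) (p q : R) (w : R -> R).
Hypotheses (p1 : 1 < p) (q1 : 1 < q) (hw : weight w).
Local Notation mu := (@lebesgue_measure R).
Local Notation r := (conj_exp p).

Let r0 : 0 < r.
Proof. by have [r1 _] := conj_expP p1; exact: lt_trans r1. Qed.

Let q0 : 0 < q. Proof. exact: lt_trans q1. Qed.

Let measurable_w_powR (s : R) (A : set R) : measurable_fun A (fun x => w x `^ s).
Proof.
apply: measurable_funTS; apply: (measurableT_comp (measurable_powR _)).
by have [] := hw.
Qed.

Lemma integral_weight_gt0 (s a b : R) : a < b ->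
  (0 < \int[mu]_(x in `]a, b[) (w x `^ s)%:E)%E.
Proof.
move=> ab; have [_ w0] := hw.
rewrite lt_neqAle integral_ge0 ?andbT => [|x _]; last by rewrite lee_fin powR_ge0.
apply/negP => /eqP/esym I0.
have [N [mN N0 DN]] : ae_eq mu `]a, b[%classic (fun x => (w x `^ s)%:E) (cst 0%E).
  apply/ae_eq_integral_abs => //; first by apply/measurable_EFinP; exact: measurable_w_powR.
  rewrite -I0; apply: eq_integral => x _; rewrite gee0_abs// lee_fin powR_ge0//.
have : (mu `]a, b[%classic <= mu N)%E.
  apply: le_measure; rewrite ?inE// => x abx; apply: DN => /= /(_ abx) [].
  by apply/eqP; rewrite gt_eqF// powR_gt0.
by rewrite N0 lebesgue_measure_itv/= lte_fin ab -EFinB lee_fin leNgt subr_gt0 ab.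
Qed.

Hypothesis hA : A_plus p q w.

(** [A_plus] bounds a product of integrals over two adjacent intervals.  Both
    factors are positive, so neither can be infinite; an auxiliary neighbour of
    [(a, b)] on the right serves for [w^q], one on the left for [w^(-r)]. *)
Lemma A_plus_integrals_finite (a b : R) : a < b ->
  (\int[mu]_(x in `]a, b[) (w x `^ q)%:E < +oo)%E /\
  (\int[mu]_(x in `]a, b[) (w x `^ (- r))%:E < +oo)%E.
Proof.
move=> ab; have [C CP] := hA.
have ninf (k : R) (x y : \bar R) (s t : R) : 0 < k -> (0 < x)%E -> (0 < y)%E ->
    0 < s -> 0 < t -> (k%:E * poweR x s * poweR y t < C%:E)%E -> (x < +oo /\ y < +oo)%E.
  move=> k0 x0 y0 s0 t0 H; split; rewrite ltey; apply/eqP => xy; move: H; rewrite xy.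
    rewrite poweRyr ?gt_eqF// gt0_muley ?lte_fin// gt0_mulye ?poweR_gt0//.
  rewrite poweRyr ?gt_eqF// gt0_muley// mule_gt0 ?lte_fin ?poweR_gt0//.
have pow0 (c d : R) : c < d -> 0 < ((d - c) `^ (1 - (p^-1 - q^-1)))^-1.
  by move=> cd; rewrite invr_gt0 powR_gt0// subr_gt0.
have iq0 : 0 < q^-1 by rewrite invr_gt0.
have ir0 : 0 < r^-1 by rewrite invr_gt0.
split.
- have b1 : b < b + 1 by rewrite ltrDl.
  by have [] := ninf _ _ _ _ _ (pow0 _ _ (lt_trans ab b1)) (integral_weight_gt0 q ab)
    (integral_weight_gt0 (- r) b1) iq0 ir0 (CP _ _ _ ab b1).
- have a1 : a - 1 < a by rewrite ltrBlDr ltrDl.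
  by have [] := ninf _ _ _ _ _ (pow0 _ _ (lt_trans a1 ab)) (integral_weight_gt0 q a1)
    (integral_weight_gt0 (- r) ab) iq0 ir0 (CP _ _ _ a1 ab).
Qed.

(** At each point [s w] or its inverse is at least [1], so
    [1 <= (s w)^q + (s w)^(-r)] for every [s > 0].  Integrating over
    [(x0 - h, x0)], which lies in [(-T, T)], gives
    [h <= s^q \int w^q + s^(-r) B] with [B] the integral of [w^(-r)] over
    [(-T, T)]; the choice [s^(-r) B = h / 2] gives the bound. *)
Lemma weight_integral_lower (T : R) : 0 < T -> exists2 c : R, 0 < c &
  forall x0 h : R, 0 <= x0 <= T -> 0 < h <= T ->
  ((c * h `^ (1 + q / r))%:E
   <= \int[mu]_(x in `](x0 - h)%R, x0[) (w x `^ q)%:E)%E.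
Proof.
move=> T0; have [_ w0] := hw.
have NTT : - T < T by rewrite gtrN.
have [_ Bfin] := A_plus_integrals_finite NTT.
have Bgt0 := integral_weight_gt0 (- r) NTT.
have [B B0 BE] : exists2 B : R, 0 < B &
    (\int[mu]_(x in `](- T)%R, T[) (w x `^ (- r))%:E = B%:E)%E.
  exists (fine (\int[mu]_(x in `](- T)%R, T[) (w x `^ (- r))%:E)%E).
    by rewrite fine_gt0// Bgt0.
  by rewrite fineK// ge0_fin_numE// ltW.
exists (2^-1 * (2 * B) `^ (- (q / r))).
  by rewrite mulr_gt0 ?powR_gt0 ?mulr_gt0.
move=> x0 h /andP[x00 x0T] /andP[h0 hT].
have xh : x0 - h < x0 by rewrite ltrBlDr ltrDl.
have [Afin _] := A_plus_integrals_finite xh.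
have [A AE] : exists A : R,
    (\int[mu]_(x in `](x0 - h)%R, x0[) (w x `^ q)%:E = A%:E)%E.
  exists (fine (\int[mu]_(x in `](x0 - h)%R, x0[) (w x `^ q)%:E)%E).
  by rewrite fineK// (ge0_fin_numE (ltW (integral_weight_gt0 q xh))).
rewrite AE lee_fin.
pose s : R := (2 * B / h) `^ r^-1.
have s0 : 0 < s by rewrite powR_gt0// divr_gt0// mulr_gt0.
have point x : 1 <= s `^ q * w x `^ q + s `^ (- r) * w x `^ (- r).
  rewrite -!powRM ?(ltW s0) ?(ltW (w0 _))//.
  have sw : 0 < s * w x by rewrite mulr_gt0.
  have [sw1|sw1] := leP 1 (s * w x).
    by rewrite ler_wpDr ?powR_ge0// -(powRr0 (s * w x)) ler_powR// ltW.
  rewrite ler_wpDl ?powR_ge0// -(powRr0 (s * w x)) ger_powR//.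
    by rewrite sw ltW.
  by rewrite oppr_le0 ltW.
have hAB : h <= s `^ q * A + s `^ (- r) * B.
  rewrite -lee_fin.
  have -> : h%:E = (\int[mu]_(x in `](x0 - h)%R, x0[) (1 : R)%:E)%E.
    have muI : mu `]x0 - h, x0[%classic = h%:E.
      by rewrite lebesgue_measure_itv/= lte_fin xh -EFinB opprB addrC subrK.
    by rewrite integral_cst// mul1e; exact/esym/muI.
  have msq (k s' : R) (D : set R) : measurable_fun D (fun x => k * w x `^ s').
    by apply: measurable_funM => //; exact: measurable_w_powR.
  apply: (@le_trans _ _ (\int[mu]_(x in `](x0 - h)%R, x0[)
      (s `^ q * w x `^ q + s `^ (- r) * w x `^ (- r))%:E)%E).
    by apply: le_integral_EFin => //; apply: measurable_funD; exact: msq.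
  rewrite ge0_integralD_EFin//;
    try by [exact: msq|move=> x _; rewrite mulr_ge0 ?powR_ge0].
  rewrite !integralZ_EFin ?powR_ge0//;
    try by [exact: measurable_w_powR|move=> x _; rewrite powR_ge0].
  rewrite AE EFinD !EFinM -BE leeD2l// lee_wpmul2l ?lee_fin ?powR_ge0//.
  apply: ge0_subset_integral => //.
  - by apply/measurable_EFinP; exact: measurable_w_powR.
  - by move=> x _; rewrite lee_fin powR_ge0.
  - move=> x; rewrite /= !in_itv/= => /andP[hx xx0].
    rewrite (lt_le_trans xx0 x0T) andbT (le_lt_trans _ hx)//.
    by rewrite lerBrDr (le_trans _ x00)// addrC subr_le0.
have Bh : s `^ (- r) * B = h / 2.
  rewrite /s -powRrM mulrN mulVf ?gt_eqF// powR_inv1 ?divr_ge0 ?mulr_ge0 ?ltW//.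
  by field; rewrite !gt_eqF.
have sA : h / 2 <= s `^ q * A by move: hAB; rewrite Bh; lra.
have -> : 2^-1 * (2 * B) `^ (- (q / r)) * h `^ (1 + q / r) = s `^ (- q) * (h / 2).
  rewrite powRD; last by rewrite (gt_eqF h0) implybT.
  have B2 : 0 <= 2 * B by rewrite mulr_ge0// ltW.
  have ih : 0 <= h^-1 by rewrite invr_ge0 ltW.
  rewrite powRr1 ?(ltW h0)// /s -powRrM (powRM _ B2 ih).
  rewrite -(powR_inv1 (ltW h0)) -powRrM mulN1r mulrN opprK [r^-1 * q]mulrC.
  by ring.
by rewrite powRN (ler_pdivrMl _ _ (powR_gt0 q s0)).
Qed.
End weights.

(** * Morrey norms against uniform and L^p norms *)

Lemma le_poweR (R : realType) (s : R) (x y : \bar R) : 0 <= s ->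
  (0 <= x)%E -> (x <= y)%E -> (poweR x s <= poweR y s)%E.
Proof.
move=> s0 x0 xy; apply: gt0_ler_poweR => //.
  by rewrite in_itv/= x0 leey.
by rewrite in_itv/= (le_trans x0 xy) leey.
Qed.

Section morrey.
Variables (R : realType) (T p q : R) (w : R -> R).
Hypotheses (T0 : 0 < T) (p1 : 1 < p) (q1 : 1 < q) (hw : weight w)
  (hA : A_plus p q w).
Local Notation leb := (@lebesgue_measure R).
Local Notation r := (conj_exp p).

Let q0 : 0 < q. Proof. exact: lt_trans q1. Qed.

(** The lower bound on the weight gives [Phi >= c h^(mu + q/r)], and the
    integral of [|f|^q] is at most [eps^q h]; the power of [h] left in the
    quotient is nonnegative, so it is bounded for [h <= T]. *)
Lemma morrey_norm_le_sup (mu : R) : mu + q / r <= 1 ->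
  exists K : R, forall (f : R -> R) (eps : R), 0 <= eps ->
    measurable_fun `]0, T[ f -> (forall x, 0 < x < T -> `|f x| <= eps) ->
    (morrey_norm T q mu q w f <= (K * eps)%:E)%E.
Proof.
move=> hmu; have [c c0 cP] := weight_integral_lower p1 q1 hw hA T0.
pose k : R := 1 - (mu + q / r).
have k0 : 0 <= k by rewrite subr_ge0.
exists ((c^-1 * T `^ k) `^ q^-1) => f eps eps0 mf feps.
apply: ge_ereal_sup => _ [x0 [h [x0T /[dup] hT /andP[h0 hleT] ->]]].
have ci : 0 <= c^-1 by rewrite invr_ge0 ltW.
have PhiL : ((c * h `^ (mu + q / r))%:E <= Phi_plus w mu q x0 h)%E.
  have -> : c * h `^ (mu + q / r) = h `^ (mu - 1) * (c * h `^ (1 + q / r)).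
    rewrite mulrCA -powRD ?(gt_eqF h0) ?implybT//; congr (_ * _ `^ _); ring.
  by rewrite EFinM /Phi_plus lee_wpmul2l ?cP// lee_fin powR_ge0.
have L0 : 0 < c * h `^ (mu + q / r) by rewrite mulr_gt0// powR_gt0.
have PhiV : ((Phi_plus w mu q x0 h)^-1 <= ((c * h `^ (mu + q / r))^-1)%:E)%E.
  rewrite -[X in (_ <= X)%E](_ : ((c * h `^ (mu + q / r))%:E^-1)%E = _); last first.
    by rewrite inver gt_eqF.
  rewrite lee_pV2 ?inE//; first by rewrite (le_trans _ PhiL)// lee_fin ltW.
  by rewrite lee_fin ltW.
have mfq : measurable_fun `]0, T[ (fun x => `|f x| `^ q).
  apply: (measurableT_comp (measurable_powR _)).
  exact: measurableT_comp.
have IE : (\int[leb]_(y in `]x0, (x0 + h)%R[ `&` `]0%R, T[) (`|f y| `^ q)%:E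
    <= (eps `^ q * h)%:E)%E.
  apply: (@le_trans _ _ (\int[leb]_(y in `]x0, (x0 + h)%R[ `&` `]0%R, T[)
    (eps `^ q)%:E)%E).
    apply: le_integral_EFin => //.
    - by apply: measurableI.
    - by apply: measurable_funS mfq => //; exact: subIsetr.
    - move=> x [_]; rewrite /= in_itv/= => xT.
      by apply: ge0_ler_powR; rewrite ?nnegrE ?(ltW q0) ?feps.
  rewrite integral_cst//; last by apply: measurableI.
  rewrite EFinM lee_wpmul2l ?lee_fin ?powR_ge0//.
  have muI : leb `]x0, (x0 + h)%R[%classic = h%:E.
    by rewrite lebesgue_measure_itv/= lte_fin ltrDl h0 -EFinB addrAC subrr add0r.
  rewrite -[X in (_ <= X)%E]muI; apply: le_measure; rewrite ?inE//.
  - by apply: measurableI.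
have I0 : (0 <= \int[leb]_(y in `]x0, (x0 + h)%R[ `&` `]0%R, T[) (`|f y| `^ q)%:E)%E.
  by apply: integral_ge0 => x _; rewrite lee_fin powR_ge0.
have Phi0 : (0 <= (Phi_plus w mu q x0 h)^-1)%E.
  by rewrite inve_ge0 (le_trans _ PhiL)// lee_fin ltW.
have bound : ((Phi_plus w mu q x0 h)^-1 *
   \int[leb]_(y in `]x0, (x0 + h)%R[ `&` `]0%R, T[) (`|f y| `^ q)%:E
   <= (c^-1 * T `^ k * eps `^ q)%:E)%E.
  apply: (le_trans (lee_pmul Phi0 I0 PhiV IE)).
  rewrite -EFinM lee_fin invfM.
  have -> : c^-1 * (h `^ (mu + q / r))^-1 * (eps `^ q * h) = c^-1 * h `^ k * eps `^ q.
    rewrite /k powRB; last by rewrite (gt_eqF h0) implybT.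
    by rewrite powRr1 ?(ltW h0)//; ring.
  rewrite ler_wpM2r ?powR_ge0// ler_wpM2l//.
  by apply: ge0_ler_powR; rewrite ?nnegrE ?(ltW h0) ?(ltW T0).
have iq : 0 <= q^-1 by rewrite invr_ge0 ltW.
apply: (le_trans (le_poweR iq (mule_ge0 Phi0 I0) bound)).
rewrite poweR_EFin lee_fin powRM ?mulr_ge0 ?powR_ge0//.
by rewrite -powRrM mulfV ?gt_eqF// powRr1.
Qed.

Lemma morrey_norm0 (lambda theta : R) (f : R -> R) : 0 < theta ->
  (forall x, 0 < x < T -> f x = 0) -> morrey_norm T theta lambda theta w f = 0%E.
Proof.
move=> th0 f0; rewrite /morrey_norm [X in ereal_sup X](_ : _ = [set 0%E]) ?ereal_sup1//.
have val x0 h : poweR ((Phi_plus w lambda theta x0 h)^-1 *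
    \int[leb]_(y in `]x0, (x0 + h)%R[ `&` `]0%R, T[) (`|f y| `^ theta)%:E)%E theta^-1 = 0%E.
  rewrite integral0_eq ?mule0 ?poweR0r// ?gt_eqF ?invr_gt0// => x [_].
  by rewrite /= in_itv/= => /f0 ->; rewrite normr0 powR0// gt_eqF.
apply/seteqP; split => [N [x0 [h [_ _ ->]]]|_ ->] /=; first exact: val.
by exists 0, T; split; rewrite ?val ?lexx ?T0 ?(ltW T0).
Qed.

(** Only the pair [x0 = 0], [h = T] of the supremum is used; there [Phi] is a
    positive real number because [w^p <= 1 + w^q]. *)
Lemma morrey_norm_Lp (beta M : R) : p < q -> exists N : R, forall f : R -> R,
  (morrey_norm T p beta p w f <= M%:E)%E ->
  (\int[leb]_(y in `]0%R, T[) (`|f y| `^ p)%:E <= N%:E)%E.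
Proof.
move=> pq; have p0 : 0 < p by exact: lt_trans p1.
have NT0 : 0 - T < 0 by rewrite sub0r oppr_lt0.
have wgt := integral_weight_gt0 hw p NT0.
have wfin : (\int[leb]_(x in `](0 - T)%R, 0%R[) (w x `^ p)%:E < +oo)%E.
  have [wq _] := A_plus_integrals_finite p1 q1 hw hA NT0.
  have [mw w0] := hw.
  have mp s (A : set R) : measurable_fun A (fun x => w x `^ s).
    by apply: measurable_funTS; exact: (measurableT_comp (measurable_powR _)).
  apply: (@le_lt_trans _ _ (\int[leb]_(x in `](0 - T)%R, 0%R[) (1 + w x `^ q)%:E)%E).
    apply: le_integral_EFin => //.
    - by move=> x _; exact: powR_ge0.
    - by apply: measurable_funD => //; exact: mp.
    - move=> x _; have [w1|w1] := leP 1 (w x).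
        by rewrite ler_wpDl// ler_powR// ltW.
      rewrite ler_wpDr ?powR_ge0// -(powRr0 (w x)) ger_powR ?w0 ?(ltW w1)//.
      exact: ltW.
  rewrite ge0_integralD_EFin//; try by [exact: mp|move=> x _; exact: powR_ge0].
  rewrite lte_add_pinfty// integral_cst// mul1e.
  have : (leb `](0 - T)%R, 0%R[%classic < +oo)%E.
    by rewrite lebesgue_measure_itv/= lte_fin NT0 -EFinB ltry.
  exact.
have [phi phi0 phiE] : exists2 phi : R, 0 < phi & Phi_plus w beta p 0 T = phi%:E.
  exists (fine (Phi_plus w beta p 0 T)).
    rewrite fine_gt0// /Phi_plus mule_gt0 ?lte_fin ?powR_gt0//=.
    by rewrite lte_mul_pinfty// lee_fin powR_ge0.
  rewrite fineK// /Phi_plus fin_numM// ge0_fin_numE//; exact: ltW.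
exists (phi * M `^ p) => f fM.
set J := (X in (X <= _)%E).
have J0 : (0 <= J)%E by apply: integral_ge0 => x _; rewrite lee_fin powR_ge0.
have le1 : (poweR (phi^-1%:E * J) p^-1 <= M%:E)%E.
  apply: le_trans fM; apply: ereal_sup_ubound; exists 0, T.
  split; rewrite ?lexx ?T0 ?(ltW T0)//.
  rewrite phiE inver gt_eqF//; congr (poweR (_ * _) _)%E.
  by rewrite /J add0r setIid.
have pJ0 : (0 <= phi^-1%:E * J)%E by rewrite mule_ge0// lee_fin invr_ge0 ltW.
have := le_poweR (ltW p0) (poweR_ge0 _ _) le1.
rewrite -poweRrM mulVf ?gt_eqF// poweRe1// poweR_EFin => le2.
have -> : J = (phi%:E * (phi^-1%:E * J))%E.
  by rewrite muleA -EFinM mulfV ?gt_eqF// mul1e.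
by rewrite EFinM lee_wpmul2l// lee_fin ltW.
Qed.

Lemma morrey_norm_ge0 (lambda theta : R) (f : R -> R) :
  (0 <= morrey_norm T theta lambda theta w f)%E.
Proof.
apply: le_trans (ereal_sup_ubound _); last first.
  by exists 0, T; split; last reflexivity; rewrite ?lexx ?T0 ?(ltW T0).
exact: poweR_ge0.
Qed.

End morrey.

(** * Compactness between the Morrey spaces *)

Theorem proposition3p4 (R : realType) (T sigma p q alpha beta mu : R)
    (w : R -> R) (hT : 0 < T) (hsigma : 0 < sigma < 1)
    (hp : 1 < p) (hq : 1 < q)
    (halpha : 2^-1 * (1 + p^-1) < alpha < 1)
    (hw : weight w) (hA : A_plus p q w)
    (hbeta : 0 <= beta < 1) (hmu : 0 <= mu < 1)
    (hpq : p^-1 - q^-1 = sigma) (hqmu : q + mu <= 2) :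
  (forall u : R -> R, morrey_space T p beta p w u ->
     \forall t \ae (@lebesgue_measure R), 0 < t < T ->
       (@lebesgue_measure R).-integrable `]0, t[
         (fun tau => (frac_kernel alpha u t tau)%:E)) /\
  compact_operator
    (morrey_space T p beta p w) (morrey_norm T p beta p w)
    (morrey_space T q mu q w) (morrey_norm T q mu q w)
    (frac_int T alpha).
Proof.
have [p0 q0] : 0 < p /\ 0 < q by split; exact: lt_trans ltr01 _.
have ip1 : p^-1 < 1 by rewrite invf_lt1.
have [al a1] := andP halpha.
have pa : p^-1 < alpha by lra.
have [sg0 sg1] := andP hsigma.
have pq : p < q.
  by rewrite -ltf_pV2 ?posrE// -subr_gt0 hpq.
have hmuk : mu + q / conj_exp p <= 1.
  have -> : q / conj_exp p = q - 1 - q * sigma.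
    by rewrite -hpq /conj_exp; field; rewrite !gt_eqF// subr_gt0.
  have : 0 <= q * sigma by rewrite mulr_ge0 ?ltW.
  by lra.
pose X := morrey_space T p beta p w.
have XLp u : X u -> exists N, Lp_ball T p N u.
  move=> [mu0 uX]; have [N NP] := morrey_norm_Lp hT hp hq hw hA beta
    (fine (morrey_norm T p beta p w u)) pq.
  exists N; split => //; apply: NP.
  by rewrite fineK// ge0_fin_numE// morrey_norm_ge0.
have Lp_le N N' u : N <= N' -> Lp_ball T p N u -> Lp_ball T p N' u.
  by move=> NN' [mu0 uN]; split => //; apply: le_trans uN _; rewrite lee_fin.
have [K KP] := morrey_norm_le_sup hT hp hq hw hA hmuk.
have mK N u : Lp_ball T p N u -> measurable_fun `]0, T[ (frac_int T alpha u).
  move=> uN; apply: uniformly_continuous_measurable => eps eps0.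
  have [delta d0 dP] := frac_int_equicontinuous N hT hp pa a1 eps0.
  by exists delta => // x y; rewrite /= !in_itv/=; exact: dP.
split.
  move=> u /XLp[N uN]; apply: aeW => t tT.
  exact: (integrable_frac_kernel hT hp pa uN).
split.
- move=> u /XLp[N uN]; split; first exact: mK uN.
  have [M MP] := frac_int_bounded N hT hp pa.
  apply: (le_lt_trans (KP _ `|M| _ (mK _ _ uN) _)); rewrite ?ltry// => x xT.
  exact: le_trans (MP u x uN xT) (ler_norm M).
- move=> a u v /XLp[N1 uN1] /XLp[N2 vN2].
  apply: morrey_norm0 => // x xT.
  have uN : Lp_ball T p (Num.max N1 N2) u.
    by apply: Lp_le uN1; rewrite le_max lexx.
  have vN : Lp_ball T p (Num.max N1 N2) v.
    by apply: Lp_le vN2; rewrite le_max lexx orbT.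
  by rewrite /= (frac_int_linear hT hp pa a uN vN xT) subrr.
- move=> B BX [M BM] v vB.
  have [N NP] := morrey_norm_Lp hT hp hq hw hA beta M pq.
  have /choice[u uP] : forall n, exists u,
      Lp_ball T p N u /\ frac_int T alpha u = v n.
    move=> n; have [u Bu uv] := vB n; exists u; split => //.
    by split; [have [] := BX _ Bu|exact/NP/BM].
  have uN n := (uP n).1; have uv n := (uP n).2.
  have [M' M'P] := frac_int_bounded N hT hp pa.
  have [||eps eps0|phi [g [phiI gM gU vg]]] :=
      @ascoli_sequence R 0 T M' `]0, T[%classic v.
  + exact: subset_itv_oo_cc.
  + by move=> n x; rewrite /= in_itv/= -uv; exact: M'P.
  + have [delta d0 dP] := frac_int_equicontinuous N hT hp pa a1 eps0.
    by exists delta => // n x y; rewrite /= !in_itv/= -uv; exact: dP.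
  have mg := uniformly_continuous_measurable gU.
  exists phi, g; split => //.
    split => //; apply: (le_lt_trans (KP _ `|M'| _ mg _)); rewrite ?ltry// => x xT.
    by apply: le_trans (ler_norm M'); apply: gM; rewrite /= in_itv.
  apply: (@squeeze_cvge _ _ _ _ (cst 0%E) _ (fun n => (K * n.+1%:R^-1)%:E)).
  + apply: nearW => n; rewrite morrey_norm_ge0//=.
    apply: KP => //.
      by apply: measurable_funB => //; rewrite -uv; exact: mK.
    by move=> x xT; apply: vg; rewrite /= in_itv.
  + exact: cvg_cst.
  + apply: cvg_EFin; first exact: nearW.
    rewrite -[X in _ --> X](mulr0 K); apply: cvgM; first exact: cvg_cst.
    exact: cvg_harmonic.
Qed.
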